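(* Let $n>3$, let $H$ be a subgroup of the symmetric group $\mathrm{Sym}_n$ that contains the cyclic group $\langle(1,2,\dots,n)\rangle$ as a normal subgroup of index $2$, and let $S_n=S_n(H)$ be the monoid with presentation $\langle a_1,\dots,a_n\mid a_1a_2\cdots a_n=a_{\sigma(1)}a_{\sigma(2)}\cdots a_{\sigma(n)},\ \sigma\in H\rangle$. Let $K$ be a field. Then the monoid algebra $K[S_n]$ is an automaton algebra with respect to the given presentation of $S_n$ and the length-lexicographical order $\ll$ on the free monoid $\mathrm{FM}_n$ on $\{a_1,\dots,a_n\}$ generated by $a_1\ll a_2\ll\cdots\ll a_n$.
   Context: The same symbols $a_1,\dots,a_n$ denote the generators of the free monoid $\mathrm{FM}_n$ and those of $S_n$. The length-lexicographical order compares words first by length and then, for words of equal length, lexicographically. A subset of $\mathrm{FM}_n$ is a regular language if it is obtained from finite subsets of $\mathrm{FM}_n$ by applying a finite number of operations of union, multiplication ($AB=\{ab\mid a\in A,\ b\in B\}$ for non-empty $A,B\subseteq\mathrm{FM}_n$) and the operation $*$ defined by $T^*=\bigcup_{i\ge1}T^i$. Let $R$ be a $K$-algebra generated by $r_1,\dots,r_n$, let $\pi:K\langle x_1,\dots,x_n\rangle\to R$ be the homomorphism from the free algebra with $\pi(x_i)=r_i$ for all $i$, and fix an order on the free monoid $\langle x_1,\dots,x_n\rangle$ compatible with multiplication. Then $R$ is an automaton algebra (in the sense of Ufnarovskii) with respect to the presentation $\pi$ and the fixed order if the ideal of the free monoid consisting of all leading monomials of (nonzero) elements of $\ker(\pi)$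 is a regular language. For $R=K[S_n]$, the presentation $\pi$ is the one sending the free generators to the generators $a_1,\dots,a_n$ of $S_n$. *)

(* Defs.v *)
From HB Require Import structures.
From mathcomp Require Import all_boot all_order all_fingroup all_algebra.
From mathcomp Require Import finmap.
From mathcomp Require Import mathcomp_extra boolp classical_sets functions cardinality.
From mathcomp Require Import generic_quotient monalg.

Set Implicit Arguments.
Unset Strict Implicit.
Unset Printing Implicit Defensive.

Import Order.TTheory GRing.Theory.
Local Open Scope ring_scope.
Local Open Scope quotient_scope.
Local Open Scope classical_set_scope.

Section RegularLanguages.
Variable I : choiceType.
Implicit Types A B T : set {fmonom I}.

Definition langM A B : set {fmonom I} := [set mmul a b | a in A & b in B].

Definition langX T (i : nat) : set {fmonom I} := iter i (langM T) [set mone].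

(* The union starts at [i = 1]: the empty word is in [langS T] only when it is
   in [T]. *)
Definition langS T : set {fmonom I} := \bigcup_(i in [set i | (0 < i)%N]) langX T i.

Inductive regular_language : set {fmonom I} -> Prop :=
| regular_finite A : finite_set A -> regular_language A
| regular_union A B :
    regular_language A -> regular_language B -> regular_language (A `|` B)
| regular_mul A B : A !=set0 -> B !=set0 ->
    regular_language A -> regular_language B -> regular_language (langM A B)
| regular_star T : regular_language T -> regular_language (langS T).

End RegularLanguages.

Section MonoidAlgebra.
Variables (K : comNzRingType) (M : monomType).

Fact malg_scalerAr (c : K) (f g : {malg K[M]}) : c *: (f * g) = f * (c *: g).
Proof.
rewrite (malgMEw (fsubset_refl (msupp f)) (msuppZ_le c g)).
rewrite malgME scaler_sumr; apply: eq_bigr => k1 _.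
rewrite scaler_sumr; apply: eq_bigr => k2 _.
apply/malgP => k; rewrite mcoeffZ !mcoeffU mcoeffZ [in RHS]mulrCA.
by rewrite mcoeffU mulrnAr.
Qed.

(* On [malg] the library declares [algType] for commutative monoids only, and a
   second instance cannot be attached to the same constant: hence this alias. *)
Definition monoid_algebra : Type := {malg K[M]}.
HB.instance Definition _ := GRing.Lalgebra.on monoid_algebra.
HB.instance Definition _ :=
  GRing.Lalgebra_isAlgebra.Build K monoid_algebra malg_scalerAr.

Definition monoid_algebra_of (x : M) : monoid_algebra := << x >>.

End MonoidAlgebra.

Lemma monoid_algebra_ofM (K : comNzRingType) (M : monomType) (x y : M) :
  monoid_algebra_of K (mmul x y) = monoid_algebra_of K x * monoid_algebra_of K y.
Proof.
transitivity (<< x >> * << y >> : {malg K[M]}); last by [].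
by rewrite malgM_def fgmulUU mulr1.
Qed.

Lemma monoid_algebra_ofZ (K : comNzRingType) (M : monomType) (c : K) (x : M) :
  c *: monoid_algebra_of K x = << c *g x >>.
Proof.
transitivity (c *: << x >> : {malg K[M]}); first by [].
by apply/malgP => j; rewrite mcoeffZ !mcoeffU mulr_natr.
Qed.

Section AutomatonAlgebras.
Variables (K : fieldType) (n : nat).

(* The free algebra as the monoid algebra of the free monoid. *)
Local Notation free_algebra := {malg K[{fmonom 'I_n}]}.

Definition eval_free (R : algType K) (r : 'I_n -> R) :
    free_algebra -> R :=
  mmap (in_alg R) (fun w : {fmonom 'I_n} => \prod_(i <- w) r i).

Definition generates (R : algType K) (r : 'I_n -> R) : Prop :=
  forall x : R, exists f, eval_free r f = x.

Definition compatible_order (le : rel {fmonom 'I_n}) : Prop :=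
  [/\ reflexive le, antisymmetric le, transitive le, total le
    & forall u v x y, le u v -> le (mmul (mmul x u) y) (mmul (mmul x v) y)].

Definition leading_monomial (le : rel {fmonom 'I_n})
    (f : free_algebra) (w : {fmonom 'I_n}) : Prop :=
  w \in msupp f /\ forall v, v \in msupp f -> le v w.

Definition leading_ideal (le : rel {fmonom 'I_n}) (R : algType K)
    (r : 'I_n -> R) : set {fmonom 'I_n} :=
  [set w | exists f, [/\ f != 0, eval_free r f = 0 & leading_monomial le f w]].

Definition automaton_algebra (R : algType K) (r : 'I_n -> R)
    (le : rel {fmonom 'I_n}) : Prop :=
  [/\ generates r, compatible_order le & regular_language (leading_ideal le r)].

End AutomatonAlgebras.

Lemma eval_freeU (K : fieldType) (n : nat) (R : algType K) (r : 'I_n -> R)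
    (c : K) (w : {fmonom 'I_n}) :
  eval_free r << c *g w >> = c *: \prod_(i <- w) r i.
Proof. by rewrite /eval_free mmapU mulr_algl. Qed.

Lemma eval_free_mul (K : fieldType) (n : nat) (R : algType K) (r : 'I_n -> R) :
  {morph eval_free r : f g / f * g}.
Proof.
have mm : mmorphism (fun w : {fmonom 'I_n} => \prod_(i <- w) r i).
  split=> [u v|]; first by rewrite fmM big_cat.
  by rewrite fm1 big_nil.
pose h : {mmorphism {fmonom 'I_n} -> R} := HB.pack (fun w : {fmonom 'I_n} => \prod_(i <- w) r i) (isMultiplicative.Build _ _ _ mm).
apply: (commr_mmap_is_multiplicative (f := in_alg R) (h := h) _).1.
by move=> g m m'; rewrite /GRing.comm /= mulr_algl mulr_algr.
Qed.

(* [seqlexi] is the lexicographic order on words over the ordered alphabet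
   ['I_n]. *)
Definition deglex (n : nat) : rel {fmonom 'I_n} := fun u v =>
  (size u < size v)%N
  || (size u == size v) && ((u : seqlexi 'I_n) <= (v : seqlexi 'I_n))%O.

Lemma deglex_compatible n : compatible_order (@deglex n).
Proof.
split.
- by move=> u; rewrite /deglex eqxx lexx orbT.
- move=> u v; rewrite /deglex.
  case: (ltngtP (size u) (size v)) => //= e /le_anti h.
  exact: val_inj.
- move=> v u w; rewrite /deglex.
  case: (ltngtP (size u) (size v)) => //= [uv _|->].
    by move=> /orP[/(ltn_trans uv)->//|/andP[/eqP<-]]; rewrite uv.
  by move=> uv; case: (ltngtP (size v) (size w)) => //= _; exact: le_trans.
- move=> u v; rewrite /deglex.
  by case: (ltngtP (size u) (size v)) => //= e; exact: le_total.
- move=> u v x y; rewrite /deglex !fmM !size_cat ltn_add2r ltn_add2l eqn_add2r eqn_add2l.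
  case: (ltngtP (size u) (size v)) => //= e.
  rewrite -!catA; elim: (x : seq _) => [|i s IH] /=; last by rewrite lexi_cons lexx /=; move=> /IH.
  case: u v e => [u] [v] /=; elim: u v => [|i u IH] [|j v] //= [e].
  rewrite !lexi_cons; case/andP => -> /=.
  by move=> /implyP h; apply/implyP => /h; exact: IH.
Qed.

Section PermutationRelations.
Variables (n : nat) (H : {set 'S_n}).

(* The generators are indexed by ['I_n], that is from 0. *)
Definition perm_word (s : 'S_n) : {fmonom 'I_n} :=
  FMonom [seq s i | i <- enum 'I_n].

Inductive Sn_congr : {fmonom 'I_n} -> {fmonom 'I_n} -> Prop :=
| Sn_congr_rel s : s \in H -> Sn_congr (perm_word 1%g) (perm_word s)
| Sn_congr_refl u : Sn_congr u u
| Sn_congr_sym u v : Sn_congr u v -> Sn_congr v u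
| Sn_congr_trans u v w : Sn_congr u v -> Sn_congr v w -> Sn_congr u w
| Sn_congr_mul u v u' v' :
    Sn_congr u v -> Sn_congr u' v' -> Sn_congr (mmul u u') (mmul v v').

Definition Sn_rel : rel {fmonom 'I_n} := fun u v => `[< Sn_congr u v >].

Fact Sn_rel_refl : reflexive Sn_rel.
Proof. by move=> u; apply/asboolP; exact: Sn_congr_refl. Qed.

Fact Sn_rel_sym : symmetric Sn_rel.
Proof. by move=> u v; apply/asboolP/asboolP; exact: Sn_congr_sym. Qed.

Fact Sn_rel_trans : transitive Sn_rel.
Proof.
by move=> v u w /asboolP uv /asboolP vw; apply/asboolP; exact: Sn_congr_trans uv vw.
Qed.

Canonical Sn_equiv := EquivRel Sn_rel Sn_rel_refl Sn_rel_sym Sn_rel_trans.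

Definition Sn : Type := {eq_quot Sn_equiv}.
HB.instance Definition _ := Choice.on Sn.
HB.instance Definition _ := EqQuotient.on Sn.

Lemma Sn_eqP (u v : {fmonom 'I_n}) : \pi_Sn u = \pi_Sn v <-> Sn_congr u v.
Proof.
split=> [/eqP|uv]; first by rewrite eqmodE => /asboolP.
by apply/eqP; rewrite eqmodE; apply/asboolP.
Qed.

Lemma Sn_congr_size u v : Sn_congr u v -> size u = size v.
Proof.
elim=> {u v} [s _|//|u v _ -> //|u v w _ -> _ -> //|u v u' v' _ e _ e'].
  by rewrite /= !size_map.
by rewrite !fmM !size_cat e e'.
Qed.

Definition Sn_mul (x y : Sn) : Sn := \pi_Sn (mmul (repr x) (repr y)).
Definition Sn_one : Sn := \pi_Sn mone.

Lemma Sn_mulE (u v : {fmonom 'I_n}) : Sn_mul (\pi_Sn u) (\pi_Sn v) = \pi_Sn (mmul u v).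
Proof. by apply/Sn_eqP/Sn_congr_mul; apply/Sn_eqP; rewrite reprK. Qed.

Fact Sn_mulA : associative Sn_mul.
Proof.
elim/quotW=> u; elim/quotW=> v; elim/quotW=> w; rewrite (Sn_mulE v w) (Sn_mulE u v).
by rewrite (Sn_mulE u) (Sn_mulE _ w) mulmA.
Qed.

Fact Sn_mul1m : left_id Sn_one Sn_mul.
Proof. by elim/quotW=> u; rewrite Sn_mulE mul1m. Qed.

Fact Sn_mulm1 : right_id Sn_one Sn_mul.
Proof. by elim/quotW=> u; rewrite Sn_mulE mulm1. Qed.

Fact Sn_unitm x y : Sn_mul x y = Sn_one -> x = Sn_one /\ y = Sn_one.
Proof.
elim/quotW: x => u; elim/quotW: y => v; rewrite Sn_mulE => /Sn_eqP/Sn_congr_size /eqP.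
rewrite -/(fdeg _) -/(fdeg mone) fdeg1 fdeg_eq0 fmM_eq1.
by case/andP => /eqP -> /eqP ->.
Qed.

HB.instance Definition _ :=
  Choice_isMonomialDef.Build Sn Sn_mulA Sn_mul1m Sn_mulm1 Sn_unitm.

Definition Sn_gen (i : 'I_n) : Sn := \pi_Sn (fmu i).

End PermutationRelations.

Lemma Sn_word n (H : {set 'S_n}) (w : seq 'I_n) :
  \big[mmul/mone]_(i <- w) Sn_gen H i = \pi_(Sn H) (FMonom w).
Proof.
elim: w => [|i w IH]; first by rewrite big_nil -fmoneE.
rewrite big_cons IH; apply: etrans (Sn_mulE _ _ _) _; congr (\pi _).
by rewrite -fmE; apply/eqP; rewrite fmP fmM fmU fmE.
Qed.

Lemma monoid_algebra_word (K : fieldType) n (H : {set 'S_n}) (w : seq 'I_n) :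
  \prod_(i <- w) monoid_algebra_of K (Sn_gen H i) = monoid_algebra_of K (\pi_(Sn H) (FMonom w)).
Proof.
rewrite -Sn_word; elim: w => [|i w IH]; first by rewrite !big_nil.
rewrite !big_cons IH.
by rewrite monoid_algebra_ofM.
Qed.

Lemma Sn_generates (K : fieldType) n (H : {set 'S_n}) :
  generates (fun i : 'I_n => monoid_algebra_of K (Sn_gen H i)).
Proof.
move=> x.
exists (\sum_(k <- msupp x) << x@_k *g repr k >>).
rewrite /eval_free raddf_sum [RHS]monalgE; apply: eq_bigr => k _.
by rewrite [LHS]eval_freeU monoid_algebra_word fmK reprK monoid_algebra_ofZ.
Qed.

(* [ordS] is the successor modulo [n]. *)
Definition ncycle (n : nat) : 'S_n := perm (@ordS_inj n).

(* Main.v *)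
Require Import Defs.
From mathcomp Require Import boolp classical_sets cardinality.
From mathcomp Require Import all_boot all_order all_fingroup all_algebra zify.
From mathcomp Require Import finmap monalg.

(* Let [c] be the [n]-cycle, [h] an element of [H] outside [<[c]>], and put
   [step true = c] and [step false = c ^ h]. The words of the presentation are
   the cycles [b, step e b, ..., step e^(n-1) b]; their common value [z] in
   [S_n] is central. Removing the first letter [j] of a cycle leaves an arc;
   the two arcs of [j] differ in [S_n] but agree once multiplied by [z]. Let [A]
   be the quotient of [S_n] identifying them.

   Since [step true] and [step false] never agree, two cycles of different kinds
   overlap in at most one letter. Hence in [A] the chains of [step e] dividing a
   word on the left are computed by a finite automaton reading the word from
   right to left, and [A] is left cancellative. So a word is minimal in its class
   in [A] iff none of its suffixes [c t] is left divisible in [A] by a letter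
   smaller than [c], a condition recognized by an automaton.

   In [S_n], two distinct words are equal iff they both contain a cycle and are
   equal in [A]. It follows that the least representative of the class of [z u]
   is [0^p w y], where [w] is the cycle of [step true] starting at [0], [0^p y] is
   the least word equal to [u] in [A], and [y] does not start with [0]. So the
   nonminimal words, which form the leading ideal, are recognized by a finite
   automaton, and Kleene's theorem applies. *)

Set Implicit Arguments.
Unset Strict Implicit.
Unset Printing Implicit Defensive.

Import Order.TTheory GRing.Theory.

(** * Kleene's theorem: the language of a finite automaton is regular *)

Section Kleene.
Import classical_sets.
Local Open Scope classical_set_scope.
Variable T : finType.
Implicit Types (A B : set {fmonom T}) (s : seq T).

Lemma langMP A B s : langM A B (FMonom s) <->
  exists u v, [/\ s = u ++ v, A (FMonom u) & B (FMonom v)].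
Proof.
split=> [[[u] Au [[v] Bv E]]|[u [v [-> Au Bv]]]].
  by exists u, v; split=> //; rewrite -[s]/(val (FMonom s)) -E [mmul _ _]fmmulE.
by exists (FMonom u) => //; exists (FMonom v) => //; exact: fmmulE.
Qed.

(** The constructor [regular_mul] asks for non-empty factors; otherwise the product is empty, hence
    finite. *)
Lemma langM_regular A B :
  regular_language A -> regular_language B -> regular_language (langM A B).
Proof.
move=> rA rB; have [A0|/set0P A0] := eqVneq A set0.
  rewrite (_ : langM A B = set0); first exact/regular_finite/finite_set0.
  by rewrite -subset0 => w [u]; rewrite A0.
have [B0|/set0P B0] := eqVneq B set0.
  rewrite (_ : langM A B = set0); first exact/regular_finite/finite_set0.
  by rewrite -subset0 => w [u _ [v]]; rewrite B0.
exact: regular_mul.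
Qed.

Lemma langX_rcons A i s s' :
  langX A i (FMonom s) -> A (FMonom s') -> langX A i.+1 (FMonom (s ++ s')).
Proof.
elim: i s => [|i IH] s.
  rewrite [langX A 0 _]/= [mone]fmoneE => -[->] As'.
  apply/langMP; exists s', [::]; rewrite cats0; split=> //.
  by rewrite /langX /= [mone]fmoneE.
move=> /langMP[u [v [-> Au Xv]]] As'; rewrite -catA.
by apply/langMP; exists u, (v ++ s'); split=> //; exact: IH.
Qed.

(** The usual Kleene star, with the empty word, unlike [langS]. *)
Definition lang_iter A := [set FMonom [::]] `|` langS A.

Lemma lang_iter_cat A s s' :
  lang_iter A (FMonom s) -> A (FMonom s') -> lang_iter A (FMonom (s ++ s')).
Proof.
case=> [[->] As'|[i _ Xs] As']; right.
  by exists 1 => //; apply: (@langX_rcons _ 0) As'; rewrite /langX /= [mone]fmoneE.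
by exists i.+1 => //; exact: langX_rcons.
Qed.

Variables (X : finType) (f : T -> X -> X).
Implicit Types (l : seq X) (x y z : X).

(* Words leading from [x] to [y], read from right to left, with all
   intermediate states in [l]. *)
Fixpoint path_lang l x y : set {fmonom T} :=
  if l is z :: l' then
    path_lang l' x y `|`
    langM (path_lang l' z y) (langM (lang_iter (path_lang l' z z)) (path_lang l' x z))
  else [set w : {fmonom T} | (size w <= 1)%N /\ foldr f x w = y].

Lemma path_lang_regular l x y : regular_language (path_lang l x y).
Proof.
elim: l x y => [|z l IH] x y.
  apply: regular_finite; apply: (@sub_finite_set _ _
    [set FMonom (seq_of_opt o) | o in [set: option T]]).
    by case=> -[|c [|d s]] [] //= _ _; [exists None|exists (Some c)].
  exact/finite_image/finite_finset.
apply: regular_union (IH _ _) _; do 2!apply: langM_regular => //.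
apply: regular_union; first exact/regular_finite/finite_set1.
exact: regular_star.
Qed.

Lemma path_lang_foldr l x y s : path_lang l x y (FMonom s) -> foldr f x s = y.
Proof.
elim: l x y s => [|z l IH] x y s; first by case.
case=> [/IH//|/langMP[u [v [-> /IH uE /langMP[v1 [v2 [-> v1E /IH v2E]]]]]]].
rewrite !foldr_cat v2E; suff -> : foldr f z v1 = z by [].
case: v1E => [[->]//|[i _]]; elim: i v1 => [|i IHi] v1.
  by rewrite /langX /= [mone]fmoneE => -[->].
by move=> /langMP[a [b [-> /IH aE /IHi bE]]]; rewrite foldr_cat bE.
Qed.

Definition inner l x s :=
  forall a b, s = a ++ b -> a <> [::] -> b <> [::] -> foldr f x b \in l.

(** Reading from right to left, the cut is made at the first visit to [z]. *)
Lemma inner_split z l x s : inner (z :: l) x s ->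
  inner l x s \/
  exists a b, [/\ s = a ++ b, b <> [::], foldr f x b = z & inner l x b].
Proof.
elim: s => [|c s IH] s_in; first by left=> -[|? ?] [].
have /IH[s_in'|[a [b [-> b0 bz b_in]]]] : inner (z :: l) x s.
  by move=> a b sE _ b0; apply: (s_in (c :: a)) => //; rewrite sE.
  case: (eqVneq s [::]) => [s0|/eqP s0].
    by left=> -[//|d [|? ?]] [|? ?] //; rewrite s0.
  have := s_in [:: c] s erefl => /(_ (fun E => ltac:(discriminate)) s0).
  rewrite inE => /orP[/eqP sz|sl]; first by right; exists [:: c], s.
  left=> -[//|d [|d' a]] b [_ sE] _ b0; first by rewrite -[b]/([::] ++ b) -sE.
  by apply: (s_in' (d' :: a)) b0.
by right; exists (c :: a), b.
Qed.

Lemma path_lang_complete l x y s :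
  inner l x s -> foldr f x s = y -> path_lang l x y (FMonom s).
Proof.
elim: l x y s => [|z l IH] x y s s_in sE.
  split=> //; case: s s_in {sE} => [|c [|d s]] // s_in.
  have := s_in [:: c] (d :: s) erefl; rewrite in_nil => no_state.
  by have : false by apply: no_state.
have shift a b : s = a ++ b -> foldr f x b = z -> inner (z :: l) z a.
  move=> {}sE bz p q aE p0 q0.
  have -> : foldr f z q = foldr f x (q ++ b) by rewrite foldr_cat bz.
  apply: (s_in p) => //.
    by rewrite sE aE catA.
  by case: (q) q0.
(* The part read after the first visit to [z] is cut at each return to [z], by induction on its
   length: the loops make up [v], and [u] leads from [z] to [y]. *)
have loop a : inner (z :: l) z a -> foldr f z a = y -> exists u v,
    [/\ a = u ++ v, path_lang l z y (FMonom u)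
      & lang_iter (path_lang l z z) (FMonom v)].
  have [N] := ubnP (size a); elim: N a => // N IHN a aN a_in aE.
  have [a_in'|[p [q [apq q0 qz q_in]]]] := inner_split a_in.
    by exists a, [::]; rewrite cats0; split=> //; [exact: IH|left].
  have [|||u [v [pE Pu Pv]]] := IHN p.
  - move: aN q0; rewrite apq size_cat; case: (q) => //= c q'; rewrite ltnS => le _.
    by apply: leq_trans le; rewrite addnS ltnS leq_addr.
  - move=> p1 p2 pE p10 p20.
    have -> : foldr f z p2 = foldr f z (p2 ++ q) by rewrite foldr_cat qz.
    apply: (a_in p1) => //.
      by rewrite apq pE catA.
    by case: (p2) p20.
  - by rewrite -aE apq foldr_cat qz.
  exists u, (v ++ q); split=> //; first by rewrite apq pE catA.
  by apply: lang_iter_cat => //; exact: IH.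
have [s_in'|[a [b [sab b0 bz b_in]]]] := inner_split s_in.
  by left; exact: IH.
right; have aE : foldr f z a = y by rewrite -bz -foldr_cat -sab.
have [u [v [auv Pu Pv]]] := loop a (shift a b sab bz) aE.
apply/langMP; exists u, (v ++ b); split=> //; first by rewrite sab auv catA.
by apply/langMP; exists v, b; split=> //; exact: IH.
Qed.

Lemma foldr_regular x (A : pred X) :
  regular_language [set w : {fmonom T} | A (foldr f x w)].
Proof.
rewrite (_ : [set _ | _] =
  \big[setU/set0]_(y <- enum A) path_lang (enum X) x y).
  elim: (enum A) => [|y ys IH].
    by rewrite big_nil; exact/regular_finite/finite_set0.
  rewrite big_cons; apply: regular_union IH; exact: path_lang_regular.
rewrite -bigcup_seq; apply/seteqP; split=> -[s] /=.
  move=> As; exists (foldr f x s); first by rewrite /= mem_enum.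
  by apply: path_lang_complete => // a b _ _ _; rewrite mem_enum.
by case=> y /=; rewrite mem_enum => Ay /path_lang_foldr->.
Qed.

End Kleene.

(** * Closure properties of the predicates decided by automata reading from right to left *)

Section Recognizable.
Local Open Scope classical_set_scope.
Variable T : finType.
Implicit Types (P Q : pred (seq T)) (s : seq T).

Definition recognizable P := exists (X : finType) (f : T -> X -> X) x (A : pred X),
  forall s, P s = A (foldr f x s).

Lemma recognizable_regular P : recognizable P ->
  regular_language [set w : {fmonom T} | P w].
Proof.
case=> X [f [x [A PE]]]; rewrite (_ : [set _ | _] = [set w | A (foldr f x (val w))]).
  exact: foldr_regular.
by apply/seteqP; split=> w /=; rewrite PE.
Qed.

Lemma eq_recognizable P Q : P =1 Q -> recognizable Q -> recognizable P.
Proof. by move=> PQ [X [f [x [A QE]]]]; exists X, f, x, A => s; rewrite PQ. Qed.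

Lemma recognizable_const b : recognizable (fun=> b).
Proof. by exists unit, (fun _ _ => tt), tt, (fun=> b). Qed.

Lemma recognizable_not P : recognizable P -> recognizable (fun s => ~~ P s).
Proof.
case=> X [f [x [A PE]]].
by exists X, f, x, (fun y => ~~ A y) => s; rewrite PE.
Qed.

Lemma foldr_pair (X Y : Type) (f : T -> X -> X) (g : T -> Y -> Y) x y s :
  foldr (fun c p => (f c p.1, g c p.2)) (x, y) s = (foldr f x s, foldr g y s).
Proof. by elim: s => //= c s ->. Qed.

Lemma recognizable_and P Q : recognizable P -> recognizable Q ->
  recognizable (fun s => P s && Q s).
Proof.
case=> X [f [x [A PE]]] [Y [g [y [B QE]]]].
exists (X * Y)%type, (fun c p => (f c p.1, g c p.2)), (x, y), (fun p => A p.1 && B p.2).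
by move=> s; rewrite foldr_pair PE QE.
Qed.

Lemma recognizable_or P Q : recognizable P -> recognizable Q ->
  recognizable (fun s => P s || Q s).
Proof.
move=> rP rQ; apply: (@eq_recognizable _ (fun s => ~~ (~~ P s && ~~ Q s))).
  by move=> s; rewrite negb_and !negbK.
by apply/recognizable_not/recognizable_and; exact: recognizable_not.
Qed.

Lemma recognizable_exists (I : finType) (P : I -> pred (seq T)) :
  (forall i, recognizable (P i)) -> recognizable (fun s => [exists i, P i s]).
Proof.
move=> rP; apply: (@eq_recognizable _ (fun s => has (P^~ s) (enum I))).
  move=> s; apply/existsP/hasP => [[i Pi]|[i _ Pi]]; exists i => //.
  by rewrite mem_enum.
elim: (enum I) => [|i r IH]; first exact: recognizable_const.
exact: recognizable_or.
Qed.

(** The added boolean is computed from the state before the last letter read; [b] is the answer for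
    the empty word. *)
Lemma recognizable_behead P (a : pred T) b : recognizable P ->
  recognizable (fun s => if s is c :: s' then a c && P s' else b).
Proof.
case=> X [f [x [A PE]]].
exists (X * bool)%type, (fun c p => (f c p.1, a c && A p.1)), (x, b), snd.
have E s : (foldr (fun c (p : X * bool) => (f c p.1, a c && A p.1)) (x, b) s).1
    = foldr f x s by elim: s => //= c s ->.
by case=> [|c s] //=; rewrite E PE.
Qed.

Lemma recognizable_prefix_cat u P : recognizable P ->
  recognizable (fun s => prefix u s && P (drop (size u) s)).
Proof.
move=> rP; elim: u => [|d u IH].
  by apply: eq_recognizable rP => s; rewrite prefix0s drop0.
apply: eq_recognizable (recognizable_behead (pred1 d) false IH) => -[|c s] //=.
by rewrite [d == c]eq_sym andbA.
Qed.

Lemma recognizable_prefix u : recognizable (prefix u).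
Proof.
apply: eq_recognizable (recognizable_prefix_cat u (recognizable_const true)) => s.
by rewrite andbT.
Qed.

Fixpoint scan (h : pred T) (L : pred (seq T)) s :=
  L s || if s is c :: s' then h c && scan h L s' else false.

Lemma scanP h (L : pred (seq T)) s :
  reflect (exists x y, [/\ s = x ++ y, all h x & L y]) (scan h L s).
Proof.
apply: (iffP idP) => [|[x [y [-> ]]]]; last first.
  by elim: x => [_ /= Ly|c x IH /= /andP[-> /IH+] Ly]; [case: y Ly => [|c y] /= ->|
    move=> ->; rewrite ?orbT].
elim: s => [|c s IH] /=; first by rewrite orbF; exists [::], [::].
case/orP => [Ls|/andP[hc /IH[x [y [-> hx Ly]]]]]; first by exists [::], (c :: s).
by exists (c :: x), y; rewrite /= hc hx.
Qed.

(** The suffixes of a word are what the automaton has read at successive times, so one boolean can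
    record the scan. *)
Lemma recognizable_scan (h : pred T) L :
  recognizable L -> recognizable (scan h L).
Proof.
case=> X [f [x [A LE]]].
pose g c (p : X * bool) := (f c p.1, A (f c p.1) || h c && p.2).
exists (X * bool)%type, g, (x, A x), snd => s.
suff -> : foldr g (x, A x) s = (foldr f x s, scan h L s) by [].
by elim: s => [|c s IH] /=; rewrite LE ?orbF // IH.
Qed.

End Recognizable.

(** * Rewriting of words in context *)

Section Rewriting.
Variables (T : Type) (R : seq T -> seq T -> Prop).
Implicit Types u v w x y l r : seq T.

Inductive rewr u : seq T -> Prop :=
| rewr_refl : rewr u u
| rewr_step x y l r : rewr u (x ++ l ++ y) -> R l r -> rewr u (x ++ r ++ y).

Lemma rewr_trans v u w : rewr u v -> rewr v w -> rewr u w.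
Proof. by move=> uv; elim=> // x y l r _; exact: rewr_step. Qed.

Lemma rewr_rel l r : R l r -> rewr l r.
Proof.
move=> lr; have := @rewr_step l [::] [::] l r.
by rewrite /= !cats0 => /(_ (rewr_refl l) lr).
Qed.

Lemma rewr_cat u v u' v' : rewr u v -> rewr u' v' -> rewr (u ++ u') (v ++ v').
Proof.
move=> uv uv'; apply: (@rewr_trans (u ++ v')).
  elim: uv' => [|x y l r _ IH lr]; first exact: rewr_refl.
  by rewrite catA; apply: rewr_step lr; rewrite -catA.
elim: uv => [|x y l r _ IH lr]; first exact: rewr_refl.
by rewrite -!catA; apply: rewr_step lr; rewrite -!catA in IH.
Qed.

Lemma rewr_catl x u v : rewr u v -> rewr (x ++ u) (x ++ v).
Proof. exact/rewr_cat/rewr_refl. Qed.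

Lemma rewr_catr y u v : rewr u v -> rewr (u ++ y) (v ++ y).
Proof. by move=> /rewr_cat; apply; exact: rewr_refl. Qed.

Lemma rewr_cons c u v : rewr u v -> rewr (c :: u) (c :: v).
Proof. exact: (@rewr_catl [:: c]). Qed.

Hypothesis R_sym : forall l r, R l r -> R r l.

Lemma rewr_sym u v : rewr u v -> rewr v u.
Proof.
elim=> [|x y l r _ IH /R_sym rl]; first exact: rewr_refl.
apply: rewr_trans IH; apply: rewr_step rl; exact: rewr_refl.
Qed.

End Rewriting.

Lemma rewr_sub (T : Type) (R R' : seq T -> seq T -> Prop) :
  (forall l r, R l r -> rewr R' l r) -> forall u v, rewr R u v -> rewr R' u v.
Proof.
move=> RR' u v; elim=> [|x y l r _ IH /RR' lr]; first exact: rewr_refl.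
by apply: rewr_trans IH _; exact/rewr_catl/rewr_catr.
Qed.

Lemma rewr_ind_eq (T U : Type) (R : seq T -> seq T -> Prop) (g : seq T -> U) :
  (forall x y l r, R l r -> g (x ++ l ++ y) = g (x ++ r ++ y)) ->
  forall u v, rewr R u v -> g u = g v.
Proof. by move=> gR u v; elim=> [//|x y l r _ ->]; exact: gR. Qed.

(** * The two congruences, and the automaton computing left divisors in [A] *)

Section TwoCycles.
Variables (T : finType) (m : nat) (step : bool -> T -> T).
Local Notation n := m.+4.

Definition seg e b l := traject (step e) b l.

Lemma size_seg e b l : size (seg e b l) = l.
Proof. exact: size_traject. Qed.

Definition cycle_rel (l r : seq T) :=
  exists e b e' b', l = seg e b n /\ r = seg e' b' n.

Definition arc e j := seg e (step e j) n.-1.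

Definition arc_rel (l r : seq T) :=
  cycle_rel l r \/ exists e j, l = arc e j /\ r = arc (~~ e) j.

Lemma cycle_rel_sym l r : cycle_rel l r -> cycle_rel r l.
Proof. by case=> e [b [e' [b' [-> ->]]]]; exists e', b', e, b. Qed.

Lemma arc_rel_sym l r : arc_rel l r -> arc_rel r l.
Proof.
case=> [/cycle_rel_sym|[e [j [-> ->]]]]; [by left|right].
by exists (~~ e), j; rewrite negbK.
Qed.

(* Equality in [S_n] and in [A] respectively. *)
Definition eqM := rewr cycle_rel.
Definition eqA := rewr arc_rel.

Lemma eqM_sym u v : eqM u v -> eqM v u.
Proof. exact: rewr_sym cycle_rel_sym u v. Qed.
Lemma eqA_sym u v : eqA u v -> eqA v u.
Proof. exact: rewr_sym arc_rel_sym u v. Qed.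
Lemma eqA_trans v u w : eqA u v -> eqA v w -> eqA u w.
Proof. exact: rewr_trans. Qed.

Lemma eqM_eqA u v : eqM u v -> eqA u v.
Proof. by apply: rewr_sub => l r lr; apply: rewr_rel; left. Qed.

Lemma eqA_size u v : eqA u v -> size u = size v.
Proof.
apply: rewr_ind_eq => x y l r lr; rewrite !size_cat.
by case: lr => [[e [b [e' [b' [-> ->]]]]]|[e [j [-> ->]]]]; rewrite !size_seg.
Qed.

Hypothesis stepn : forall e b, iter n (step e) b = b.
Hypothesis step_neq : forall e b, step e b <> step (~~ e) b.

Lemma step_inj e : injective (step e).
Proof.
by apply: (can_inj (g := iter n.-1 (step e))) => b; rewrite -iterSr; exact: stepn.
Qed.

Definition step_pred e b := iter n.-1 (step e) b.

Lemma step_predK e b : step e (step_pred e b) = b.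
Proof. exact: stepn. Qed.

Lemma seg_arc e b : seg e b n = b :: arc e b.
Proof. by []. Qed.

Lemma arc_rcons e b : seg e (step e b) n = rcons (arc e b) b.
Proof. by rewrite /seg trajectSr -iterSr stepn. Qed.

Lemma eqM_seg e b e' b' : eqM (seg e b n) (seg e' b' n).
Proof. by apply: rewr_rel; exists e, b, e', b'. Qed.

Lemma eqA_arc e e' b : eqA (arc e b) (arc e' b).
Proof.
have [->|ne] := eqVneq e e'; first exact: rewr_refl.
by apply: rewr_rel; right; exists e, b; case: e e' ne => [] [].
Qed.

(** To pass a letter [c], exchange the cycle for the one ending with [c]: then [c] followed by it is
    the cycle starting at [c], followed by [c]. *)
Lemma eqM_seg_central e b x : eqM (x ++ seg e b n) (seg e b n ++ x).
Proof.
elim: x => [|c x IH]; first by rewrite cats0; exact: rewr_refl.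
apply: (@rewr_trans _ _ (c :: seg e b n ++ x)); first exact: rewr_cons.
apply: (@rewr_trans _ _ (c :: seg e (step e c) n ++ x)).
  by apply/rewr_cons/rewr_catr/eqM_seg.
rewrite arc_rcons cat_rcons -cat_cons -seg_arc; exact/rewr_catr/eqM_seg.
Qed.

(* The possible sets of left divisors: [None] if [z] divides the word,
   [Some (inl j)] if the arcs of [j] do, [Some (inr None)] for the empty word,
   and [Some (inr (Some (b, l, l')))] if [b] is the only letter dividing the
   word, as the start of chains of lengths at most [l] for [step true] and [l']
   for [step false]. *)
Definition head_state := option (T + option (T * 'I_m.+3 * 'I_m.+3)).

Definition head1 : head_state := Some (inr None).
Definition headZ : head_state := None.
Definition headD j : head_state := Some (inl j).

(** The greatest length, at most [n], of a chain of [step e] from [c] dividing a word with state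
    [x]. In state [inl j], the first letter of the arc of the other kind counts as a chain of length
    1. *)
Definition head_len (x : head_state) e c : nat :=
  match x with
  | None => n
  | Some (inl j) => if c == step e j then n.-1 else c == step (~~ e) j
  | Some (inr None) => 0
  | Some (inr (Some (b, l, l'))) => if c == b then (if e then l : nat else l') else 0
  end.

(** A new letter [c] extends the chains starting at its two successors; a chain of length [n.-1]
    from [c] is the arc of [step_pred e c]. *)
Definition head_cons c (x : head_state) : head_state :=
  let l := (head_len x true (step true c)).+1 in
  let l' := (head_len x false (step false c)).+1 in
  if (n <= l) || (n <= l') then headZ
  else if l == n.-1 then headD (step_pred true c)
  else if l' == n.-1 then headD (step_pred false c)
  else Some (inr (Some (c, inord l, inord l'))).

Definition head_of s := foldr head_cons head1 s.

Lemma head_len_le x e c : head_len x e c <= n.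
Proof.
case: x => [[j|[[[b l] l']|]]|] //=.
  by case: ifP => // _; case: eqP.
by case: ifP => // _; case: e; apply/ltnW/(leq_trans (ltn_ord _)).
Qed.

(** Lengths stored in a state are below [m.+3], that is [n.-1], so this value can only come from an
    arc. *)
Lemma head_len_arc x e c : head_len x e c = n.-1 -> x = headD (step_pred e c).
Proof.
case: x => [[j|[[[b l] l']|]]|] //=.
- case: eqP => [-> _|_]; last by case: eqP.
  by have -> : step_pred e (step e j) = j by apply: (@step_inj e); rewrite step_predK.
- by case: ifP => // _ E; case: e E => E; [move: (ltn_ord l)|move: (ltn_ord l')];
    rewrite E ltnn.
- by move/eqP; rewrite eqn_leq ltnn.
Qed.

Lemma head_len_cycle x e c : head_len x e c = n -> x = headZ.
Proof.
case: x => [[j|[[[b l] l']|]]|] //=.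
- case: ifP => _; first by move=> /eqP; rewrite eqn_leq ltnn andbF.
  by case: eqP.
- by case: ifP => // _ E; case: e E => E; [move: (ltn_ord l)|move: (ltn_ord l')];
    rewrite E ltnNge leqW.
Qed.

Lemma head_lenD e j : head_len (headD j) e (step e j) = n.-1.
Proof. by rewrite /= eqxx. Qed.

Lemma head_cons_cases c x :
  [\/ exists2 f, n.-1 <= head_len x f (step f c) & head_cons c x = headZ,
      exists2 f, head_len x f (step f c) = n.-2
        & head_cons c x = headD (step_pred f c) |
      (forall f, head_len x f (step f c) < n.-2) /\
      forall e b, head_len (head_cons c x) e b =
        if b == c then (head_len x e (step e c)).+1 else 0].
Proof.
rewrite /head_cons; case: ifP => [|/negbT]; first rewrite !ltnS => /orP[le|le].
- by apply: Or31; exists true.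
- by apply: Or31; exists false.
rewrite negb_or -!ltnNge !ltnS => /andP[lt1 lt2].
case: eqP => [[E]|/eqP ne1]; first by apply: Or32; exists true.
case: eqP => [[E]|/eqP ne2]; first by apply: Or32; exists false.
have {lt1}l1: head_len x true (step true c) < n.-2.
  by rewrite ltn_neqAle lt1 -eqSS ne1.
have {lt2}l2: head_len x false (step false c) < n.-2.
  by rewrite ltn_neqAle lt2 -eqSS ne2.
apply: Or33; split=> [[]//|e b] /=.
by case: eqP => // _; case: e; rewrite inordK.
Qed.

Lemma head_len_cons c x e :
  head_len (head_cons c x) e c = minn n (head_len x e (step e c)).+1.
Proof.
case: (head_cons_cases c x) => [[f le ->]|[f E ->]|[lt ->]].
- apply/esym/minn_idPl; rewrite ltnS.
  move: le; rewrite leq_eqVlt => /orP[/eqP/esym/head_len_arc->|le].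
    have -> : step_pred f (step f c) = c by apply: (@step_inj f); rewrite step_predK.
    by rewrite head_lenD.
  have /head_len_cycle-> // : head_len x f (step f c) = n.
  by apply/eqP; rewrite eqn_leq head_len_le.
- have [->|ne] := eqVneq e f.
    by rewrite -{2}(step_predK f c) head_lenD E (minn_idPr _).
  have {ne}-> : e = ~~ f by move: ne; case: (e); case: (f).
  have /eqP/negPf nc := @step_neq (~~ f) c; rewrite negbK in nc.
  (* As [n.-2] is at least 2, the state [x] is not [headD]: [step f c] is the only letter dividing
     the word, and [step (~~ f) c] is another letter. *)
  have -> : head_len x (~~ f) (step (~~ f) c) = 0.
    case: x E => [[j|[[[b l] l']|]]|] //=.
    - case: ifP => _; first by move=> /eqP; rewrite eqn_leq ltnn.
      by case: eqP.
    - by case: ifP => // /eqP <- _; rewrite nc.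
    - by move=> /eqP; rewrite eqn_leq leqNgt ltnW.
  have /eqP/negPf ne := @step_neq f (step_pred f c); rewrite step_predK in ne.
  by rewrite /head_len /headD ne negbK step_predK eqxx.
- by rewrite eqxx; have := lt e; lia.
Qed.

Lemma head_len_seg e b l x : 0 < l ->
  head_len (foldr head_cons x (seg e b l)) e b =
    minn n (l + head_len x e (iter l (step e) b)).
Proof.
elim: l b => // -[_ b _|l IH b _]; first by rewrite /= head_len_cons.
by rewrite [seg _ _ _]/= head_len_cons IH // -!iterSr; lia.
Qed.

Lemma head_cycle e b x : foldr head_cons x (seg e b n) = headZ.
Proof.
by apply: (@head_len_cycle _ e b); rewrite head_len_seg // (minn_idPl _) ?leq_addr.
Qed.

Lemma head_arc e j x :
  foldr head_cons x (arc e j) = if 0 < head_len x e j then headZ else headD j.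
Proof.
have E: head_len (foldr head_cons x (arc e j)) e (step e j) =
    minn n (n.-1 + head_len x e j).
  by rewrite head_len_seg // -iterSr stepn.
case: ltnP => w.
  by apply: (@head_len_cycle _ e (step e j)); rewrite E; lia.
rewrite (@head_len_arc (foldr _ _ _) e (step e j)); last by rewrite E; lia.
by congr headD; apply: (@step_inj e); rewrite step_predK.
Qed.

(** True of the states reached by words: both lengths stored with a letter are then positive. *)
Lemma head_len_gt0 s e e' c : (0 < head_len (head_of s) e c) = (0 < head_len (head_of s) e' c).
Proof.
case: s => //= b s; case: (head_cons_cases b (head_of s)) => [[f _ ->]|[f _ ->]|[_ E]] //.
  by case: e e' => [] [] //=; do 2!case: eqP.
by rewrite !E; case: ifP.
Qed.

Lemma head_cat u v : head_of (u ++ v) = foldr head_cons (head_of v) u.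
Proof. exact: foldr_cat. Qed.

(** Before a given word, both arcs of [j] lead to [headZ] if [j] divides that word, and to [headD j]
    otherwise. *)
Lemma eqA_head u v : eqA u v -> head_of u = head_of v.
Proof.
apply: rewr_ind_eq => x y l r lr; rewrite !head_cat; congr foldr.
case: lr => [[e [b [e' [b' [-> ->]]]]]|[e [j [-> ->]]]].
  by rewrite !head_cycle.
by rewrite !head_arc (head_len_gt0 _ e (~~ e)).
Qed.

(** The lengths read off a state are attained: a dividing cycle can be exchanged for any other
    cycle, a dividing arc for the other arc of the same letter. *)
Lemma head_len_eqA s e c l : l <= head_len (head_of s) e c -> exists r, eqA s (seg e c l ++ r).
Proof.
have short e' b l' k x y : l' <= k -> eqA x (seg e' b k ++ y) ->
    exists r, eqA x (seg e' b l' ++ r).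
  move=> /subnKC<-; rewrite /seg trajectD -catA => xE.
  by eexists; exact: xE.
elim: s e c l => [|b s IH] e c l.
  by rewrite leqn0 => /eqP->; exists [::]; exact: rewr_refl.
have long f k : k <= head_len (head_of s) f (step f b) ->
    exists r, eqA (b :: s) (seg f b k.+1 ++ r).
  by move=> /IH[r]; exists r; exact: rewr_cons.
rewrite /=; case: (head_cons_cases b (head_of s)) => [[f le ->]|[f E ->]|[_ ->]].
- move=> le_l; have [r sE] := long f n.-1 le.
  apply: (@short _ _ _ n _ r) le_l _.
  by apply: eqA_trans sE _; exact/rewr_catr/eqM_eqA/eqM_seg.
- have [r] := long f n.-2 (eq_leq (esym E)).
  rewrite -{2}(step_predK f b) => sE.
  have {}sE f' : eqA (b :: s) (arc f' (step_pred f b) ++ r).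
    by apply: eqA_trans sE _; exact/rewr_catr/eqA_arc.
  rewrite /=; case: eqP => [->|_]; first by move=> le; exact: short le (sE e).
  case: eqP => [->|_].
    case: l => [|[|//]] _; first by exists (b :: s); exact: rewr_refl.
    by eexists; exact: sE (~~ e).
  by rewrite leqn0 => /eqP->; exists (b :: s); exact: rewr_refl.
- case: eqP => [->|_]; last first.
    by rewrite leqn0 => /eqP->; exists (b :: s); exact: rewr_refl.
  move=> le_l; have [r sE] := long e _ (leqnn _).
  exact: short sE.
Qed.

(** * Left cancellation in [A] *)

Lemma eqA_cons_head s c t : eqA s (c :: t) -> 0 < head_len (head_of s) true c.
Proof. by move=> /eqA_head->; rewrite /= head_len_cons leq_min. Qed.

Lemma head_eqA_cons s c : 0 < head_len (head_of s) true c -> exists t, eqA s (c :: t).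
Proof. exact: head_len_eqA. Qed.

(** The ways in which [b :: s] and [c :: t] can be equal in [A]: same first letter, a cycle dividing
    both, or the two arcs of one letter [j], each time with a common remainder. *)
Inductive eqA_heads b s c t : Prop :=
| heads_eq of b = c & eqA s t
| heads_cycle r of eqA s (arc true b ++ r) & eqA t (arc true c ++ r)
| heads_arc e j r of b = step e j & c = step (~~ e) j
  & eqA s (seg e (step e b) n.-2 ++ r)
  & eqA t (seg (~~ e) (step (~~ e) c) n.-2 ++ r).

Lemma arc_heads e b j : b = step e j -> arc e b = seg e (step e b) n.-2 ++ [:: j].
Proof. by move=> ->; rewrite /arc /seg trajectSr -!iterSr stepn cats1. Qed.

(** Cancellation in words of length at most [N] will come from the induction in [eqA_consP]; it
    compares the remainders of two factorizations of [t]. *)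
Lemma eqA_heads_trans N b s c t d u :
  (forall p r r', size (p ++ r) <= N -> eqA (p ++ r) (p ++ r') -> eqA r r') ->
  size t = N ->
  eqA_heads b s c t -> eqA_heads c t d u -> eqA_heads b s d u.
Proof.
move=> cancel tN.
have sz x y : eqA t (x ++ y) -> size (x ++ y) <= N.
  by move=> /eqA_size <-; rewrite tN.
have eqr p r r' : eqA t (p ++ r) -> eqA t (p ++ r') -> eqA r r'.
  move=> tr tr'; apply: (cancel p); first exact: sz tr.
  exact: eqA_trans (eqA_sym tr) tr'.
(* If [c :: t] is divisible both by a cycle and by an arc of [j], then [r'] equals [j :: r] in [A],
   and this [j] completes the other arc to a cycle. *)
have arc_cycle r e j r' d' u' : eqA t (arc true c ++ r) ->
    c = step e j -> d' = step (~~ e) j ->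
    eqA t (seg e (step e c) n.-2 ++ r') ->
    eqA u' (seg (~~ e) (step (~~ e) d') n.-2 ++ r') -> eqA u' (arc true d' ++ r).
  move=> tE cE dE tE' uE.
  have rE : eqA r' (j :: r).
    apply: eqr tE' _; rewrite -cat1s catA -arc_heads //.
    by apply: eqA_trans tE _; exact/rewr_catr/eqA_arc.
  apply: (eqA_trans uE); apply: (@eqA_trans (arc (~~ e) d' ++ r)).
    by rewrite (arc_heads dE) -catA; exact: rewr_catl.
  exact/rewr_catr/eqA_arc.
case=> [<- s_t|r sE tE|e j r bE cE sE tE].
- case=> [<- tu|r tE uE|e j r -> -> tE uE].
  + by apply: heads_eq => //; exact: eqA_trans tu.
  + by apply: heads_cycle uE; exact: eqA_trans tE.
  + by apply: heads_arc uE => //; exact: eqA_trans tE.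
- case=> [<- tu|r' tE' uE|e j r' cE dE tE' uE].
  + by apply: heads_cycle sE _; apply: eqA_trans tE; exact: eqA_sym.
  + apply: heads_cycle sE _; apply: eqA_trans uE _; apply: rewr_catl.
    exact: eqr tE' tE.
  + exact: heads_cycle sE (arc_cycle _ _ _ _ _ _ tE cE dE tE' uE).
- have s_cycle r0 : eqA t (arc true c ++ r0) -> eqA s (arc true b ++ r0).
    by move=> tE0; apply: (arc_cycle r0 (~~ e) j r); rewrite ?negbK.
  case=> [<- tu|r' tE' uE|e' j' r' cE' dE tE' uE].
  + by apply: (heads_arc bE cE sE); apply: eqA_trans tE; exact: eqA_sym.
  + exact: heads_cycle (s_cycle _ tE') uE.
  (* Two exchanges of arcs in a row: for [e' = ~~ e] the second undoes the first. *)
  + have [e'E|e'E] := eqVneq e' (~~ e).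
      rewrite {e'}e'E negbK in cE' dE tE' uE *.
      have jE : j = j' by apply: (@step_inj (~~ e)); rewrite -cE.
      rewrite -jE -bE in dE; subst d; apply: heads_eq => //.
      apply: (eqA_trans sE); apply/eqA_sym/(eqA_trans uE)/rewr_catl/eqA_sym.
      exact: eqr tE tE'.
    have {}e'E : e' = e by move: e'E; case: (e'); case: (e).
    subst e'.
    (* Now [t] starts with chains of both kinds, of length at least 2, at the distinct letters
       [step e c] and [step (~~ e) c]. Only [headD c] and [headZ] allow this, so a cycle divides
       [c :: t]. *)
    have wt2 f r1 : eqA t (seg f (step f c) n.-2 ++ r1) ->
        1 < head_len (head_of t) f (step f c).
      move=> /eqA_head->; rewrite head_cat head_len_seg //; lia.
    have wt1 : n.-1 <= head_len (head_of t) e (step e c).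
      have := wt2 _ _ tE'; have := wt2 _ _ tE.
      case: (head_of t) => [[i|[[[i l] l']|]]|] //=.
        case: eqP => [/step_inj->|_]; last by case: eqP.
        by rewrite eqxx.
      case: eqP => // iE; case: eqP => // iE'.
      by case: (@step_neq e c); rewrite iE.
    have [r0 tE0] := head_len_eqA wt1.
    have {}tE0 : eqA t (arc true c ++ r0).
      by apply: eqA_trans tE0 _; exact/rewr_catr/eqA_arc.
    exact: heads_cycle (s_cycle _ tE0) (arc_cycle _ _ _ _ _ _ tE0 cE' dE tE' uE).
Qed.

(** Induction on the length, then on the rewriting chain: a single step falls under [eqA_heads], and
    steps compose by [eqA_heads_trans]. *)
Lemma eqA_consP b s c t : eqA (b :: s) (c :: t) -> eqA_heads b s c t.
Proof.
have [N] := ubnP (size s); elim: N b s c t => // N IH b s c t; rewrite ltnS => sN.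
(* With equal first letters the arc case contradicts [step_neq], and the other two cases make the
   tails equal. *)
have cancel p r r' : size (p ++ r) <= size s -> eqA (p ++ r) (p ++ r') -> eqA r r'.
  elim: p => //= a p IHp ps /IH[|_|r1 E /eqA_sym E'|].
  - exact: leq_trans ps sN.
  - by apply: IHp; exact: ltnW.
  - by apply: IHp; [exact: ltnW|exact: eqA_trans E E'].
  - by move=> e j r1 -> /step_neq.
move Ew: (b :: s) => w; move Ew': (c :: t) => w' ww'.
elim: ww' => [|x y l r wx IHw lr] in c t Ew' *.
  by move: Ew'; rewrite -Ew => -[-> ->]; apply: heads_eq => //; exact: rewr_refl.
have [c0 [t0 [E0 lastE]]] : exists c0 t0, c0 :: t0 = x ++ l ++ y /\
    eqA_heads c0 t0 c t.
  case: x {wx IHw} Ew' => [|a x] /= Ew'; last first.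
    exists a, (x ++ l ++ y); split=> //; case: Ew' => -> ->.
    by apply: heads_eq => //; apply/rewr_catl/rewr_catr/rewr_rel.
  case: lr Ew' => [[e [b0 [e' [b' [-> ->]]]]]|[e [j [-> ->]]]] [-> tE].
    exists b0, (arc e b0 ++ y); split=> //.
    have {tE}-> : t = arc e' b' ++ y := tE.
    by apply: (@heads_cycle _ _ _ _ y); exact/rewr_catr/eqA_arc.
  exists (step e j), (seg e (step e (step e j)) n.-2 ++ y); split=> //.
  have {tE}-> : t = seg (~~ e) (step (~~ e) (step (~~ e) j)) n.-2 ++ y := tE.
  by apply: (@heads_arc _ _ _ _ e j y) => //; exact: rewr_refl.
apply: (@eqA_heads_trans (size s)) lastE => //; last exact: IHw.
have := eqA_size wx; rewrite -E0 -Ew => -[]//.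
Qed.

Lemma eqA_cancel x u v : eqA (x ++ u) (x ++ v) -> eqA u v.
Proof.
elim: x => //= c x IH /eqA_consP[|r E /eqA_sym E'|e j r -> /step_neq //] //.
by apply: IH; exact: eqA_trans E E'.
Qed.

(** * From [A] back to [S_n], by multiplication with a cycle *)

Definition has_cycle s := exists x e b y, s = x ++ seg e b n ++ y.

Lemma cycle_arcM b e j : eqM (seg true b n ++ arc e j) (seg true b n ++ arc true j).
Proof.
(* both sides equal [arc true j ++ [:: j] ++ arc e j], by centrality of the cycle *)
apply: (@rewr_trans _ _ (seg true (step true j) n ++ arc e j)).
  exact/rewr_catr/eqM_seg.
rewrite arc_rcons cat_rcons -seg_arc.
apply: rewr_trans (eqM_seg_central _ _ _); apply: rewr_catl; exact: eqM_seg.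
Qed.

(** Centrality brings the cycle next to the arc to be exchanged, where [cycle_arcM] applies. *)
Lemma eqM_eqA_cycle b u v : eqA u v -> eqM (seg true b n ++ u) (seg true b n ++ v).
Proof.
elim=> [|x y l r _ IH lr]; first exact: rewr_refl.
apply: (rewr_trans IH).
have swap w w' : eqM (seg true b n ++ w) (seg true b n ++ w') ->
    eqM (seg true b n ++ x ++ w ++ y) (seg true b n ++ x ++ w' ++ y).
  move=> E; have central z : eqM (seg true b n ++ x ++ z) (x ++ seg true b n ++ z).
    by rewrite !catA; apply/rewr_catr/eqM_sym/eqM_seg_central.
  apply: rewr_trans (central _) _; apply: rewr_trans (eqM_sym (central _)).
  by apply: rewr_catl; rewrite !catA; exact: rewr_catr.
apply: swap; case: lr => [lr|[e [j [-> ->]]]].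
  by apply: rewr_catl; exact: rewr_rel.
apply: rewr_trans (cycle_arcM _ _ _) _; apply: eqM_sym; exact: cycle_arcM.
Qed.

Lemma has_cycle_eqM b s : has_cycle s -> exists u, eqM s (seg true b n ++ u).
Proof.
case=> x [e [b' [y ->]]]; exists (x ++ y); rewrite !catA; apply: rewr_catr.
by apply: rewr_trans (eqM_seg_central _ _ _) _; exact/rewr_catr/eqM_seg.
Qed.

(** Each step replaces a cycle by a cycle, so a word without cycles is alone in its class. *)
Lemma eqM_has_cycle u v : eqM u v -> u = v \/ has_cycle u /\ has_cycle v.
Proof.
elim=> [|x y l r _ IH [e [b [e' [b' [lE ->]]]]]]; first by left.
rewrite {}lE in IH.
right; split; last by exists x, e', b', y.
by case: IH => [->|[]//]; exists x, e, b, y.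
Qed.

End TwoCycles.

(** * Lexicographic comparison of words *)

Section Lexicographic.
Variable n : nat.
Implicit Types u v x y : seqlexi 'I_n.

Lemma lexi_lt_cons (b c : 'I_n) u v : b < c -> ((b :: u : seqlexi _) <= c :: v)%O.
Proof. by move=> bc; rewrite lexi_cons !leEord ltnW //= leqNgt bc. Qed.

Lemma lexi_eq_cons (c : 'I_n) u v : ((c :: u : seqlexi _) <= c :: v)%O = (u <= v)%O.
Proof. by rewrite lexi_cons lexx. Qed.

Lemma lexi_cons_cases (b c : 'I_n) u v :
  ((b :: u : seqlexi _) <= c :: v)%O -> b < c \/ b = c /\ (u <= v)%O.
Proof.
rewrite lexi_cons !leEord leq_eqVlt => /andP[/orP[/eqP/val_inj->|]]; last by left.
by rewrite leqnn; right.
Qed.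

Lemma lexi_cat u v x y : size u = size v ->
  (u <= v)%O -> (x <= y)%O -> ((u ++ x : seqlexi _) <= v ++ y)%O.
Proof.
elim: u v => [|b u IH] [|c v] //= [uv] /lexi_cons_cases[bc|[-> le]] xy.
  exact: lexi_lt_cons.
by rewrite lexi_eq_cons; exact: IH.
Qed.

End Lexicographic.

(** * Least representatives in [A] and in [S_n] *)

Section MinimalWords.
Variables (m : nat) (step : bool -> 'I_m.+4 -> 'I_m.+4).
Local Notation n := m.+4.
Local Notation seg := (seg step).
Local Notation eqA := (@eqA _ m step).
Local Notation eqM := (@eqM _ m step).
Local Notation head_of := (@head_of _ m step).
Local Notation head_len := (@head_len _ m step).
Local Notation lexi u v := ((u : seqlexi 'I_n) <= (v : seqlexi 'I_n))%O.

Hypothesis stepn : forall e b, iter n (step e) b = b.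
Hypothesis step_neq : forall e b, step e b <> step (~~ e) b.
Hypothesis step0 : forall e, 0 < step e ord0.
Hypothesis seg0_min : forall e b, lexi (seg true ord0 n) (seg e b n).
Implicit Types s u v w x y : seq 'I_n.

Definition improvable s :=
  if s is c :: _ then [exists j : 'I_n, (j < c) && (0 < head_len (head_of s) true j)]
  else false.

Definition reducible := scan xpredT improvable.

Lemma reducible_cons c s : reducible (c :: s) = improvable (c :: s) || reducible s.
Proof. by []. Qed.

(** Greedy choice: take out the smallest letter dividing the word, then treat the rest. *)
Lemma eqA_irreducible s : exists2 u, eqA s u & ~~ reducible u.
Proof.
have [N] := ubnP (size s); elim: N s => // N IH [|c s] sN.
  by exists [::] => //; exact: rewr_refl.
have c_div : 0 < head_len (head_of (c :: s)) true c.
  by apply: (eqA_cons_head stepn step_neq); exact: rewr_refl.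
case: (@arg_minnP _ c (fun j => 0 < head_len (head_of (c :: s)) true j) val c_div) => j.
move=> j_div j_min.
have [t stE] := head_eqA_cons stepn j_div.
have /IH[u tu red_u] : size t < N by have [<-] := eqA_size stE.
have su : eqA (c :: s) (j :: u) by apply: eqA_trans stE _; exact: rewr_cons.
exists (j :: u) => //; rewrite reducible_cons (negPf red_u) orbF.
apply/existsP => -[i /andP[ij]]; rewrite -(eqA_head stepn step_neq su) => /j_min.
by rewrite leqNgt ij.
Qed.

(** A smaller first letter of [v] would divide [u] and make it improvable; equal first letters
    cancel in [A]. *)
Lemma irreducible_lexi u v : ~~ reducible u -> eqA u v -> lexi u v.
Proof.
elim: u v => [|c u IH] [|d v] // red_u uv; first by have := eqA_size uv.
move: red_u; rewrite reducible_cons negb_or => /andP[imp_u red_u].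
case: (ltngtP c d) => [cd|dc|/val_inj cd].
- exact: lexi_lt_cons.
- case/negP: imp_u; apply/existsP; exists d; rewrite dc.
  exact: (eqA_cons_head stepn step_neq uv).
- rewrite -{d}cd in uv *; rewrite lexi_eq_cons; apply: IH => //.
  exact: (eqA_cancel stepn step_neq (x := [:: c])).
Qed.

Lemma reducible_nseq0 p y : reducible (nseq p ord0 ++ y) = reducible y.
Proof.
elim: p => //= p IH; rewrite [LHS]reducible_cons IH.
by rewrite /improvable; case: existsP => // -[j /andP[]].
Qed.

Definition starts0 s := ohead s == Some ord0.

Definition normal_tail y := ~~ starts0 y && ~~ reducible y.

(** The best place for the cycle is just after the leading zeros. Further right, a positive letter
    stands where the left-hand word has the 0 of its cycle; further left, a cycle starting at 0
    brings a positive second letter too early. *)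
Lemma insert_cycle_lexi p y e b x x' : ~~ starts0 y ->
  size (nseq p ord0 ++ y) = size (x ++ x') -> lexi (nseq p ord0 ++ y) (x ++ x') ->
  lexi (nseq p ord0 ++ seg true ord0 n ++ y) (x ++ seg e b n ++ x').
Proof.
move=> y0; elim: p x => [|p IH] [|c x].
- by move=> _ le; apply: lexi_cat (seg0_min e b) le; rewrite !size_seg.
- case: y y0 => // d y d0 _ /lexi_cons_cases le; apply: lexi_lt_cons.
  have {}d0 : 0 < d by rewrite lt0n; apply: contra d0 => /eqP/(@val_inj _ _ _ d ord0) ->.
  by case: le => [/(ltn_trans d0)|[<-]].
- move=> _ _; case: (posnP b) => [/(@val_inj _ _ _ b ord0)->|b0]; last first.
    exact: lexi_lt_cons.
  rewrite [nseq _ _ ++ _]/= [seg e _ _ ++ _]/= lexi_eq_cons.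
  (* After the first 0 the left-hand word has another 0, the other one [step e ord0], positive by
     [step0]. *)
  by case: p {IH} => [|p]; apply: lexi_lt_cons.
- move=> /= [sz] /lexi_cons_cases[c0|[<-]]; first exact: lexi_lt_cons.
  by rewrite lexi_eq_cons; exact: IH.
Qed.

Definition normal w := exists p y,
  w = nseq p ord0 ++ seg true ord0 n ++ y /\ normal_tail y.

Lemma split_nseq0 s : exists p y, s = nseq p ord0 ++ y /\ ~~ starts0 y.
Proof.
elim: s => [|c s [p [y [-> y0]]]]; first by exists 0, [::].
have [->|c0] := eqVneq c ord0; first by exists p.+1, y.
by exists 0, (c :: nseq p ord0 ++ y).
Qed.

Lemma eqM_cycle_swap e b x y : eqM (x ++ seg e b n ++ y) (seg true ord0 n ++ x ++ y).
Proof.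
rewrite !catA; apply: rewr_catr; apply: rewr_trans (eqM_seg_central _ _ _ _) _ => //.
exact/rewr_catr/eqM_seg.
Qed.

(** Bring a cycle to the front, replace the rest by an irreducible word equal to it in [A], and move
    the cycle past the leading zeros. *)
Lemma eqM_normal s : has_cycle m step s -> exists2 w, normal w & eqM s w.
Proof.
move=> /(has_cycle_eqM stepn ord0)[u su].
have [u0 uu0 red_u0] := eqA_irreducible u.
have [p [y [u0E y0]]] := split_nseq0 u0.
rewrite u0E reducible_nseq0 in red_u0.
exists (nseq p ord0 ++ seg true ord0 n ++ y).
  by exists p, y; rewrite /normal_tail y0 red_u0.
apply: (rewr_trans su); apply/eqM_sym/(rewr_trans (eqM_cycle_swap _ _ _ _)).
by rewrite -u0E; apply: eqM_sym; exact: eqM_eqA_cycle.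
Qed.

(** If [v] differs from [w] it contains a cycle; taking a cycle out of both words leaves words equal
    in [A], the one from [w] being irreducible. *)
Lemma normal_lexi w v : normal w -> eqM w v -> lexi w v.
Proof.
case=> p [y [-> /andP[y0 red_y]]] wv.
have [<-|[_ [x [e [b [x' vE]]]]]] := eqM_has_cycle wv; first exact: lexx.
rewrite {v}vE in wv *.
have E : eqA (nseq p ord0 ++ y) (x ++ x').
  apply: (eqA_cancel stepn step_neq (x := seg true ord0 n)); apply: eqM_eqA.
  apply: rewr_trans (eqM_cycle_swap _ _ _ _); apply: rewr_trans wv.
  exact/eqM_sym/eqM_cycle_swap.
apply: insert_cycle_lexi => //; first exact: eqA_size E.
by apply: irreducible_lexi => //; rewrite reducible_nseq0.
Qed.

Lemma nonminimalP w :
  (exists v, [/\ eqM w v, v <> w & lexi v w]) <-> has_cycle m step w /\ ~ normal w.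
Proof.
split=> [[v [wv vw le]]|[cyc_w nw]].
  split=> [|/normal_lexi/(_ wv) le']; first by case: (eqM_has_cycle wv) => [/esym|[]].
  by apply: vw; apply: (@le_anti _ (seqlexi 'I_n)); apply/andP.
have [v nv wv] := eqM_normal cyc_w; exists v; split=> // [vw|].
  by apply: nw; rewrite -vw.
exact/(normal_lexi nv)/eqM_sym.
Qed.

Definition cycle_prefix s := [exists e, exists b, prefix (seg e b n) s].

Definition normal_suffix s :=
  prefix (seg true ord0 n) s && normal_tail (drop n s).

Definition nonminimal w :=
  scan xpredT cycle_prefix w && ~~ scan (pred1 ord0) normal_suffix w.

Lemma has_cycleP w : reflect (has_cycle m step w) (scan xpredT cycle_prefix w).
Proof.
apply: (iffP (scanP _ _ _)) => [[x [s [-> _]]]|[x [e [b [y ->]]]]].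
  by case/existsP=> e /existsP[b /prefixP[y ->]]; exists x, e, b, y.
exists x, (seg e b n ++ y); split=> //; first exact: all_predT.
by apply/existsP; exists e; apply/existsP; exists b; exact: prefix_prefix.
Qed.

Lemma normalP w : reflect (normal w) (scan (pred1 ord0) normal_suffix w).
Proof.
apply: (iffP (scanP _ _ _)) => [[x [s [-> /all_pred1P x0]]]|[p [y [-> y_tail]]]].
  case/andP=> /prefixP[y ->]; rewrite -[X in drop X](size_seg step true ord0 n).
  by rewrite drop_size_cat // => y_tail; exists (size x), y; rewrite -x0.
exists (nseq p ord0), (seg true ord0 n ++ y); split=> //.
  by apply/all_pred1P; rewrite size_nseq.
rewrite /normal_suffix prefix_prefix -[X in drop X](size_seg step true ord0 n).
by rewrite drop_size_cat.
Qed.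

Lemma nonminimalE w :
  nonminimal w <-> exists v, [/\ eqM w v, v <> w & lexi v w].
Proof.
rewrite nonminimalP; split=> [/andP[/has_cycleP ? /normalP]|[]] //.
by move=> /has_cycleP ? /normalP ?; apply/andP.
Qed.

End MinimalWords.

(** * The automaton for nonminimal words *)

Section NonminimalRecognizable.
Variables (m : nat) (step : bool -> 'I_m.+4 -> 'I_m.+4).

Lemma recognizable_improvable : recognizable (improvable step).
Proof.
(* The boolean is needed because the states [headZ] and [headD] do not retain the first letter. *)
pose g c (p : head_state _ m * bool) := let x := head_cons step c p.1 in
  (x, [exists j : 'I_m.+4, (j < c) && (0 < head_len step x true j)]).
exists (head_state 'I_m.+4 m * bool)%type, g, (head1 _ m, false), snd.
have gE s : (foldr g (head1 _ m, false) s).1 = head_of m step s by elim: s => //= c s ->.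
by case=> //= c s; rewrite gE.
Qed.

Lemma recognizable_normal_tail : recognizable (normal_tail step).
Proof.
apply: recognizable_and; apply: recognizable_not.
  apply: eq_recognizable (recognizable_behead (pred1 ord0) false
    (recognizable_const _ true)) => -[|c s] //=.
  by rewrite andbT.
exact/recognizable_scan/recognizable_improvable.
Qed.

Lemma recognizable_nonminimal : recognizable (nonminimal step).
Proof.
apply: recognizable_and; last apply: recognizable_not; apply: recognizable_scan.
  by do 2!apply: recognizable_exists => ?; exact: recognizable_prefix.
apply: eq_recognizable (recognizable_prefix_cat (seg step true ord0 m.+4)
  recognizable_normal_tail) => s.
by rewrite size_seg.
Qed.

End NonminimalRecognizable.

(** * Powers and centralizer of the [n]-cycle *)

Section CycleGroup.
Variable m : nat.
Local Notation n := m.+4.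
Local Notation c := (ncycle n).
Implicit Types (x : 'I_n) (s t : 'S_n).

Lemma ncycleX k x : val ((c ^+ k)%g x) = (x + k) %% n.
Proof.
rewrite permX; elim: k => [|k IH]; first by rewrite addn0 modn_small.
by rewrite iterS permE /= IH -addn1 modnDml addn1 addnS.
Qed.

Lemma ncycleE x : val (c x) = (x + 1) %% n.
Proof. by rewrite permE /= addn1. Qed.

Lemma ncycle_ord0 x : (c ^+ x)%g ord0 = x.
Proof. by apply: val_inj; rewrite ncycleX add0n modn_small. Qed.

Lemma ncycle_neq x : c x <> x.
Proof.
move=> /(congr1 val); rewrite ncycleE => E.
have : x + 1 = x + 0 %[mod n] by rewrite E addn0 modn_small.
by move/eqP; rewrite eqn_modDl.
Qed.

(** Powers of [c] are translations modulo [n], determined by one value. *)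
Lemma ncycle_free k x : (c ^+ k)%g x = c x -> (c ^+ k)%g = c.
Proof.
move=> /(congr1 val); rewrite ncycleX ncycleE => /eqP.
rewrite eqn_modDl => /eqP E; apply/permP => y; apply: val_inj.
by rewrite ncycleX ncycleE -modnDmr E modnDmr.
Qed.

(** Since [c] is transitive, [s] is determined by its value at 0, which some power of [c] shares. *)
Lemma commute_ncycle s : commute s c -> s \in <[c]>%g.
Proof.
move=> sc; suff -> : s = (c ^+ s ord0)%g by exact: mem_cycle.
apply/permP => x; rewrite -{1}[x]ncycle_ord0 -permM -(commuteX x sc) permM.
by rewrite -{1}[s ord0]ncycle_ord0 -!permM -!expgD addnC expgD permM ncycle_ord0.
Qed.

Lemma iter_ncycle x : iter n c x = x.
Proof. by rewrite -permX; apply: val_inj; rewrite ncycleX modnDr modn_small. Qed.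

Lemma perm_word_traject s t : (forall x, s (c x) = t (s x)) ->
  perm_word s = FMonom (traject t (s ord0) n).
Proof.
move=> st; rewrite /perm_word; congr FMonom.
apply: (@eq_from_nth _ (s ord0)); first by rewrite size_map size_traject size_enum_ord.
move=> i; rewrite size_map size_enum_ord => lt_i.
rewrite nth_traject // (nth_map ord0) ?size_enum_ord //.
have -> : nth ord0 (enum 'I_n) i = iter i c ord0.
  by apply: ord_inj; rewrite nth_enum_ord // -permX [RHS]ncycleX add0n modn_small.
by elim: i {lt_i} => //= i IH; rewrite st IH.
Qed.

End CycleGroup.

(** * The defining words of [S_n] are the cycles of [c] and of its conjugate *)

Section IndexTwo.
Variables (m : nat) (H : {group 'S_m.+4}).
Local Notation n := m.+4.
Local Notation c := (ncycle n).
Hypothesis normal_cycle : (<[c]> <| H)%g.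
Hypothesis index_cycle : #|H : <[c]>|%g = 2.

Lemma index2_rep : exists2 h, h \in H & h \notin <[c]>%g.
Proof.
apply/subsetPn/negP => sHc; have := index_cycle.
by rewrite (_ : <[c]>%g = H :> {set _}) ?indexgg //; apply/eqP; rewrite eqEsubset sHc normal_sub.
Qed.

Variable h : 'S_n.
Hypotheses (hH : h \in H) (hc : h \notin <[c]>%g).

Definition cycle_step (e : bool) : 'S_n := if e then c else (c ^ h)%g.

Lemma cycle_stepn e b : iter n (cycle_step e) b = b.
Proof.
case: e; first exact: iter_ncycle.
rewrite -permX -conjXg (_ : (c ^+ n)%g = 1%g) ?conj1g ?perm1 //.
by apply/permP => x; rewrite permX iter_ncycle perm1.
Qed.

(** By normality [c ^ h] is a power of [c]; agreeing with [c] at one point it would equal [c], and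
    [h] would centralize [c], hence lie in [<[c]>]. *)
Lemma conj_cycle_neq x : cycle_step false x <> cycle_step true x.
Proof.
have := cycle_id c; rewrite -(memJ_norm _ (subsetP (normal_norm normal_cycle) h hH)).
case/cycleP=> k /= E; rewrite E => /ncycle_free cE; case/negP: hc.
by apply: commute_ncycle; apply: commute_sym; rewrite /commute conjgC E cE.
Qed.

Lemma cycle_step_neq e b : cycle_step e b <> cycle_step (~~ e) b.
Proof. by case: e; [move/esym|]; exact: conj_cycle_neq. Qed.

Lemma cycle_step_neq_id e b : cycle_step e b <> b.
Proof.
case: e; first exact: ncycle_neq.
rewrite /cycle_step conjgE !permM => /(canRL (permK h)).
exact: ncycle_neq.
Qed.

Lemma perm_word1 : perm_word (1 : 'S_n)%g = FMonom (seg cycle_step true ord0 n).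
Proof. by rewrite (@perm_word_traject _ _ c) ?perm1 // => x; rewrite !perm1. Qed.

Lemma perm_word_seg s : s \in H ->
  exists e b, perm_word s = FMonom (seg cycle_step e b n).
Proof.
move=> sH; have [/cycleP[k ->]|sc] := boolP (s \in <[c]>%g).
  exists true, ((c ^+ k)%g ord0); apply: perm_word_traject => x.
  by rewrite -!permM -expgS -expgSr.
exists false, (s ord0); apply: perm_word_traject => x.
suff [k ->] : exists k, s = (c ^+ k * h)%g.
  by rewrite -!permM /cycle_step conjgE !mulgA mulgK -expgS -expgSr.
suff : s \in (<[c]> :* h)%g by case/rcosetP=> _ /cycleP[k ->] ->; exists k.
(* Index 2 leaves a single coset outside [<[c]>], by counting. *)
suff -> : (<[c]> :* h)%g = H :\: <[c]>%g by rewrite inE sc.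
apply/eqP; rewrite eqEcard; apply/andP; split.
  apply/subsetP => _ /rcosetP[y yc ->]; rewrite inE groupMl // hc.
  by rewrite groupM // (subsetP (normal_sub normal_cycle)).
have := Lagrange (normal_sub normal_cycle); rewrite index_cycle => cardH.
rewrite card_rcoset cardsD (setIidPr (normal_sub normal_cycle)) -cardH.
by rewrite muln2 -addnn addnK.
Qed.

Lemma seg_perm_word e b :
  exists2 s, s \in H & perm_word s = FMonom (seg cycle_step e b n).
Proof.
have cH k : (c ^+ k)%g \in H.
  by rewrite (subsetP (normal_sub normal_cycle)) ?mem_cycle.
case: e.
  exists (c ^+ b)%g; first exact: cH.
  rewrite (@perm_word_traject _ _ c) ?ncycle_ord0 // => x.
  by rewrite -!permM -expgS -expgSr.
(* Products of permutations act from left to right, so this one sends 0 to [h^-1 b], then to [b]. *)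
exists (c ^+ (h^-1 b)%g * h)%g; first exact: groupM (cH _) hH.
rewrite (@perm_word_traject _ _ (c ^ h)%g) => [|x].
  by rewrite permM ncycle_ord0 permKV.
by rewrite -!permM /cycle_step conjgE !mulgA mulgK -expgS -expgSr.
Qed.

Lemma Sn_congr_eqM u v : Sn_congr H u v <-> eqM m cycle_step u v.
Proof.
split.
  elim=> {u v} [s sH|u|u v _|u v w _ uv _ vw|u v u' v' _ uv _ uv'].
  - have [e [b ->]] := perm_word_seg sH; rewrite perm_word1; exact: eqM_seg.
  - exact: rewr_refl.
  - exact: eqM_sym.
  - exact: rewr_trans vw.
  - by rewrite [mmul u u']fmmulE [mmul v v']fmmulE; exact: rewr_cat.
have seg1 e b : Sn_congr H (perm_word 1%g) (FMonom (seg cycle_step e b n)).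
  by have [s sH <-] := seg_perm_word e b; exact: Sn_congr_rel.
case: u v => [u] [v] /=; elim=> [|x y l r _ IH [e [b [e' [b' [lE rE]]]]]].
  exact: Sn_congr_refl.
have cat3 k : FMonom (x ++ k ++ y) = mmul (FMonom x) (mmul (FMonom k) (FMonom y)).
  by rewrite [mmul (FMonom k) _]fmmulE [RHS]fmmulE.
apply: Sn_congr_trans IH _; rewrite !cat3.
apply: Sn_congr_mul; first exact: Sn_congr_refl.
apply: Sn_congr_mul; last exact: Sn_congr_refl.
by rewrite lE rE; apply: Sn_congr_trans (seg1 _ _); apply: Sn_congr_sym.
Qed.

Lemma cycle_step_gt0 e : 0 < cycle_step e ord0.
Proof.
rewrite lt0n; apply/eqP => E; apply: (@cycle_step_neq_id e ord0).
exact: val_inj.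
Qed.

(** Among cycles starting at 0 the second letter decides: it is 1 for [c], and neither 0 nor 1 for
    [c ^ h]. *)
Lemma cycle_seg_min e b :
  ((seg cycle_step true ord0 n : seqlexi 'I_n) <= seg cycle_step e b n)%O.
Proof.
case: (posnP b) => [/(@val_inj _ _ _ b ord0)->|b0]; last exact: lexi_lt_cons.
case: e => //; rewrite /seg trajectS [traject (cycle_step false) _ _]trajectS.
rewrite lexi_eq_cons !trajectS; apply: lexi_lt_cons.
have c1 : cycle_step true ord0 = 1 :> nat by rewrite permE.
rewrite c1 ltn_neqAle cycle_step_gt0 andbT -c1; apply/eqP => /val_inj.
exact: cycle_step_neq.
Qed.

End IndexTwo.

Local Open Scope ring_scope.
Local Open Scope quotient_scope.

(** * Leading monomials of the kernel, and the conclusion *)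

Section LeadingIdeal.
Variables (K : fieldType) (n : nat) (H : {set 'S_n}).
Local Notation gen := (fun i : 'I_n => monoid_algebra_of K (Sn_gen H i)).

Lemma eval_freeE (f : {malg K[{fmonom 'I_n}]}) :
  eval_free gen f =
    \sum_(v <- msupp f) (<< f@_v *g \pi_(Sn H) v >> : monoid_algebra K (Sn H)).
Proof.
apply: eq_bigr => v _.
by rewrite monoid_algebra_word fmK mulr_algl monoid_algebra_ofZ.
Qed.

(** If no other monomial of [f] were congruent to [w], the class of [w] would have coefficient
    [f@_w], which is not 0, in the image of [f]. Conversely [w - v] lies in the kernel. *)
Lemma leading_idealP (le : rel {fmonom 'I_n}) w : compatible_order le ->
  leading_ideal le gen w <-> exists v, [/\ Sn_congr H w v, v <> w & le v w].
Proof.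
case=> le_refl _ _ _ _; split=> [[f [_ f0 [w_f w_max]]]|[v [wv vw le_vw]]].
- apply: contrapT => no_v.
  have := congr1 (mcoeff (\pi_(Sn H) w)) f0.
  rewrite eval_freeE [mcoeff _ 0]mcoeff0 raddf_sum /=.
  rewrite (big_rem w) //= mcoeffUU big_seq_cond big1 ?addr0.
    by apply/eqP; rewrite mcoeff_neq0.
  move=> v /andP[v_f _]; rewrite mcoeffU; case: eqP => // /esym/Sn_eqP wv.
  case: no_v; exists v; split=> //.
    by move=> vE; move: v_f; rewrite vE mem_rem_uniq ?inE ?eqxx ?fset_uniq.
  by apply: w_max; exact: mem_rem v_f.
- pose f : {malg K[{fmonom 'I_n}]} := << w >> - << v >>.
  have fw : f@_w = 1.
    by rewrite mcoeffB !mcoeffU1 eqxx (negPf (introN eqP vw)) subr0.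
  exists f; split.
  + by apply/eqP => f0; move: fw; rewrite f0 mcoeff0 => /esym/eqP; rewrite oner_eq0.
  + rewrite /eval_free raddfB; apply/eqP; rewrite subr_eq0; apply/eqP.
    rewrite [LHS]eval_freeU [RHS]eval_freeU !monoid_algebra_word !fmK.
    by have /Sn_eqP-> := wv.
  + split=> [|u]; first by rewrite -mcoeff_neq0 fw oner_neq0.
    move=> /(fsubsetP (msuppB_le _ _)); rewrite !msuppU1 !inE.
    by case/orP=> /eqP->.
Qed.

End LeadingIdeal.

(** Congruent words have equal length, so only the lexicographic part matters within a class. *)
Lemma deglex_lexi n (u v : {fmonom 'I_n}) : size u = size v ->
  deglex u v = ((u : seqlexi 'I_n) <= (v : seqlexi 'I_n))%O.
Proof. by move=> uv; rewrite /deglex uv ltnn eqxx. Qed.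

Theorem theorem3p1 (n : nat) (H : {group 'S_n}) (K : fieldType)
  (n_gt3 : (3 < n)%N)
  (normal_cycle : (<[ncycle n]> <| H)%g)
  (index_cycle : #|H : <[ncycle n]>|%g = 2)
  : automaton_algebra (fun i : 'I_n => monoid_algebra_of K (Sn_gen H i))
      (@deglex n).
Proof.
split; [exact: Sn_generates|exact: deglex_compatible|].
case: n n_gt3 H normal_cycle index_cycle => [|[|[|[|m]]]] // _ H nc ic.
have [h hH hc] := index2_rep nc ic.
rewrite (_ : leading_ideal _ _ =
    [set w : {fmonom 'I_m.+4} | nonminimal (cycle_step h) w]%classic).
  exact/recognizable_regular/recognizable_nonminimal.
have nonminE w := nonminimalE (@cycle_stepn m h) (cycle_step_neq nc hH hc)
  (@cycle_step_gt0 m h) (cycle_seg_min nc hH hc) w.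
apply/seteqP; split=> w /=.
  move=> /(leading_idealP _ _ _ (deglex_compatible _))[v [wv vw le_vw]].
  apply/nonminE; exists v; split; first exact/(Sn_congr_eqM nc ic hH hc).
    by move/val_inj.
  by rewrite -deglex_lexi // (Sn_congr_size wv).
move=> /nonminE[v [wv vw le_vw]].
apply/(leading_idealP _ _ _ (deglex_compatible _)); exists (FMonom v).
have {}wv : Sn_congr H w (FMonom v) by apply/(Sn_congr_eqM nc ic hH hc).
split=> //; first by move=> vE; apply: vw; rewrite -vE.
by rewrite deglex_lexi // (Sn_congr_size wv).
Qed.
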